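(* Let $n\ge 3$ and $a,b\ge 1$ be integers and let $f_2$ be the number of faces with two vertices of the legal complex of the weight game $W(a,b)$ played on the cycle $C_n$ with $n$ vertices, i.e. the number of legal positions with exactly two pieces. Then $$f_2=N_{LL}+N_{LR}+N_{RR},$$ where $$N_{LL}=\begin{cases} 0 & \text{if } 2a>n,\\ \frac{n(n-2a+1)}{2} & \text{if } 2a\le n,\end{cases}\qquad N_{RR}=\begin{cases} 0 & \text{if } 2b>n,\\ \frac{n(n-2b+1)}{2} & \text{if } 2b\le n,\end{cases}$$ are the numbers of legal positions consisting of exactly two Left pieces, respectively exactly two Right pieces, and $$N_{LR}=\begin{cases} 0 & \text{if } a+b>n,\\ n(n-a-b+1) & \text{if } a+b\le n,\end{cases}$$ is the number of legal positions consisting of exactly one Left and one Right piece.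
   Context: The weight game $W(a,b)$ on a graph $B$ (the board) is the following two-player game. Starting with the empty board, Left places pieces of weight $a$ and Right places pieces of weight $b$; a piece of weight $w$ covers a connected set of $w$ distinct vertices, all of which must be empty when the piece is placed. Pieces are never moved or removed, and there are no further rules. Left and Right pieces are distinguishable by owner, even when $a=b$. A position is a set of pieces on the board. It is legal exactly when the pieces cover pairwise disjoint vertex sets; order of play is irrelevant, and moves need not alternate. On the cycle $C_n$, with vertices $\mathbb{Z}/n$ in clockwise order, a piece of weight $w\le n$ is specified by its owner and its left end $i\in\mathbb{Z}/n$ (the end in counter-clockwise direction), and covers the vertices $i,i+1,\dots,i+w-1$. The legal complex is the simplicial complex whose faces are the legal positions (vertices are the legal one-piece positions), and $f_i$ denotes the number of faces with $i$ vertices, i.e. of legal positions with exactly $i$ pieces. *)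

(* Defs.v *)
From HB Require Import structures.
From mathcomp Require Import all_boot all_order all_algebra.

Set Implicit Arguments.
Unset Strict Implicit.
Unset Printing Implicit Defensive.

Import GRing.Theory.

Inductive player := Left | Right.

Definition is_left (o : player) : bool := if o is Left then true else false.
Definition player_of_bool (c : bool) : player := if c then Left else Right.
Lemma is_leftK : cancel is_left player_of_bool. Proof. by case. Qed.
HB.instance Definition _ := Finite.copy player (can_type is_leftK).

Definition weight (a b : nat) (o : player) : nat :=
  if o is Left then a else b.

(* The cycle C_n has vertex set 'Z_n, which is Z/n only for n >= 2.
   A pair (owner, left end) names a piece only if its weight is at most n:
   this is required in [legal], since for a larger weight the set [covered]
   would wrap around and no longer have as many elements as the weight. *)
Definition piece (n : nat) : finType := (player * 'Z_n)%type.

Definition covered (n a b : nat) (p : piece n) : {set 'Z_n} :=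
  [set (p.2 + k%:R)%R | k : 'I_(weight a b p.1)].

Definition position (n : nat) : finType := {set piece n}.

Definition legal (n a b : nat) (S : position n) : bool :=
  [forall p in S, weight a b p.1 <= n] &&
  [forall p in S, forall q in S,
     (p != q) ==> [disjoint covered a b p & covered a b q]].

(* The one-piece position {p} is identified with p, so that a face of the
   legal complex is a set of pieces. *)
Definition legal_complex (n a b : nat) : {set position n} :=
  [set S : position n | legal a b S].

Definition f_ (n a b i : nat) : nat :=
  #|[set S in legal_complex n a b | #|S| == i]|.

Definition pieces_of (n : nat) (o : player) (S : position n) : {set piece n} :=
  [set p in S | p.1 == o].

Definition legal_count (n a b l r : nat) : nat :=
  #|[set S in legal_complex n a b |
      (#|pieces_of Left S| == l) && (#|pieces_of Right S| == r)]|.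

(* Main.v *)
Require Import Defs.
From mathcomp Require Import all_boot all_order all_algebra zify ring.

Set Implicit Arguments.
Unset Strict Implicit.
Unset Printing Implicit Defensive.

Import GRing.Theory Num.Theory.
Local Open Scope ring_scope.

(** Two-piece positions are counted through ordered pairs of pieces, each
    position arising from exactly two of them. Pieces of weights [w], [w'] with
    left ends [i], [j] are disjoint iff [w <= d] and [d + w' <= n], where [d] is
    the clockwise distance from [i] to [j]; so for given owners there are [n]
    choices of [i] and [n + 1 - w - w'] (truncated at 0) choices of [d]. *)

Lemma card_ordered_pairs (T : finType) (P : pred {set T}) :
  #|[set xy : T * T | (xy.1 != xy.2) && P [set xy.1; xy.2]]|
  = (2 * #|[set S : {set T} | (#|S| == 2) && P S]|)%N.
Proof.
set A := [set xy | _]; set B := [set S | _].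
rewrite -sum1_card (partition_big (fun xy => [set xy.1; xy.2]) (mem B)) /=; last first.
  by case=> x y; rewrite !inE /= cards2 => /andP[-> ->].
rewrite mulnC -sum_nat_const; apply: eq_bigr => S.
rewrite inE => /andP[/cards2P[x [y [nxy ->]]] Pxy].
(* The fibre of the pairing map over [[set x; y]] consists of the two orderings, which differ
   because [x != y]. *)
rewrite sum1_card -(_ : #|[set (x, y); (y, x)]| = 2%N); last first.
  by rewrite cards2 xpair_eqE negb_and nxy.
apply: eq_card => -[u v]; rewrite !inE /= !xpair_eqE.
apply/idP/idP; last first.
  case/orP=> /andP[/eqP-> /eqP->]; rewrite unfold_in /= !inE /=.
    by rewrite nxy Pxy eqxx.
  by rewrite eq_sym nxy setUC Pxy eqxx.
rewrite unfold_in /= inE /= => /andP[/andP[nuv _] /eqP E].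
have: u \in [set x; y] by rewrite -E set21.
have: v \in [set x; y] by rewrite -E set22.
rewrite !inE => /orP[]/eqP ev /orP[]/eqP eu; rewrite eu ev ?eqxx ?orbT //.
  by rewrite eu ev eqxx in nuv.
by rewrite eu ev eqxx in nuv.
Qed.

(** Since [0 < w'], the bound [d + w' <= n] already forces [d < n], so the ordinals counted fill the
    whole interval from [w] to [n - w']; truncated subtraction gives 0 when it is empty. *)
Lemma card_ord_range (n w w' : nat) : (0 < w')%N ->
  #|[set d : 'I_n | (w <= d)%N && (d + w' <= n)%N]| = (n.+1 - (w + w'))%N.
Proof.
case: w' => // w' _; rewrite cardsE -sum1_card.
under eq_bigl => d do rewrite unfold_in /=.
rewrite -(big_mkord (fun d => (w <= d)%N && (d + w'.+1 <= n)%N) (fun=> 1%N)).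
transitivity (\sum_(w <= d < n - w') 1)%N; last first.
  by rewrite sum_nat_const_nat muln1; lia.
rewrite [RHS](big_nat_widen _ _ n) ?leq_subr //.
by rewrite [RHS](big_nat_widenl _ 0) //; apply: eq_bigl => d /=; lia.
Qed.

Section Cycle.
Variables (m a b : nat).
(** With the length in the form [m.+2], ['Z_n] computes to ['I_n], so vertices are ordinals below
    the length. *)
Local Notation n := m.+2.
Hypotheses (ha : (1 <= a)%N) (hb : (1 <= b)%N).
Implicit Types (p q : piece n) (x y : 'Z_n).

Lemma weight_gt0 o : (0 < weight a b o)%N.
Proof. by case: o. Qed.

Lemma val_ZpD x y : (x + y < n)%N -> nat_of_ord (x + y) = (x + y)%N.
Proof. by move=> ?; rewrite /= modn_small. Qed.

Lemma val_ZpN x : x != 0 -> nat_of_ord (- x) = (n - x)%N.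
Proof. by rewrite -(inj_eq val_inj) /= => nx0; rewrite modn_small //; lia. Qed.

(** An index [k] below the weight is below [n], hence is not reduced modulo [n]: it is the clockwise
    distance from the left end to [x]. *)
Lemma mem_covered p x : (weight a b p.1 <= n)%N ->
  (x \in covered a b p) = (nat_of_ord (x - p.2)%R < weight a b p.1)%N.
Proof.
move=> wn; apply/imsetP/idP => [[k _ ->]|lt_w].
  rewrite addrC addKr val_Zp_nat // modn_small //.
  exact: leq_trans (ltn_ord k) wn.
by exists (Ordinal lt_w) => //; rewrite -[LHS](subrK p.2) addrC -[in LHS](natr_Zp (x - _)).
Qed.

Definition apart p q :=
  let d := nat_of_ord (q.2 - p.2) in
  (weight a b p.1 <= d)%N && (d + weight a b q.1 <= n)%N.

(** It suffices to test the two left ends: that of [q] avoids [p] iff [w <= d], and that of [p], at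
    distance [n - d] from that of [q], avoids [q] iff [w' <= n - d]. *)
Lemma disjoint_coveredE p q :
  (weight a b p.1 <= n)%N -> (weight a b q.1 <= n)%N ->
  [disjoint covered a b p & covered a b q] = apart p q.
Proof.
move=> wp wq; rewrite /apart.
have gtp := weight_gt0 p.1; have gtq := weight_gt0 q.1.
apply/idP/idP => [/pred0P dis|/andP[le_d d_le]]; last first.
  apply/pred0P => x /=; apply/negP; rewrite !mem_covered // => /andP[xp xq].
  (* For a common vertex [x] this sum does not wrap around, as [x - q.2] is below [w' <= n - d]; so
     [x] lies at distance at least [d >= w] from [p.2]. *)
  have E : x - p.2 = (q.2 - p.2) + (x - q.2) by ring.
  move: xp; rewrite E val_ZpD; lia.
have dis_at x : ~~ ((x \in covered a b p) && (x \in covered a b q)).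
  by apply/negbT/dis.
have le_d : (weight a b p.1 <= (q.2 - p.2)%R)%N.
  by have := dis_at q.2; rewrite !mem_covered // subrr gtq andbT -leqNgt.
rewrite le_d leqNgt; apply/negP => lt_n.
have := dis_at p.2; rewrite !mem_covered // subrr gtp -leqNgt.
rewrite -opprB val_ZpN; first by move: (nat_of_ord _) lt_n => d; lia.
(* The distance back is [n - d] only for nonzero [d]; [d = 0] would contradict [0 < w <= d]. *)
by apply/eqP => d0; rewrite d0 leqNgt gtp in le_d.
Qed.

(** [apart] also encodes the other conditions: [w <= d < n] and [w' <= n] bound the weights, and
    [p = q] would give [d = 0 < w]. *)
Lemma legal_pair p q : (p != q) && legal a b [set p; q] = apart p q.
Proof.
have gtp := weight_gt0 p.1; have gtq := weight_gt0 q.1.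
apply/idP/idP => [/and3P[npq /forall_inP W /forall_inP D]|pq].
  have [pS qS] := (set21 p q, set22 p q).
  rewrite -disjoint_coveredE ?W //.
  by have /forall_inP/(_ q qS)/implyP -> := D p pS.
have /andP[le_d d_le] := pq.
have wp := leq_trans le_d (ltnW (ltn_ord (q.2 - p.2))).
have wq := leq_trans (leq_addl _ _) d_le.
have dis : [disjoint covered a b p & covered a b q] by rewrite disjoint_coveredE.
apply/and3P; split.
- by apply: contraTneq pq => ->; rewrite /apart subrr; case: (weight _ _ _) gtq.
- by apply/forall_inP => r; rewrite !inE => /orP[]/eqP->.
apply/forall_inP => r; rewrite !inE => rS.
apply/forall_inP => s; rewrite !inE => sS; apply/implyP.
by case/orP: rS => /eqP->; case/orP: sS => /eqP->; rewrite ?eqxx // disjoint_sym.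
Qed.

Lemma card_apart o o' :
  #|[set pq : piece n * piece n |
      [&& pq.1.1 == o, pq.2.1 == o' & apart pq.1 pq.2]]|
  = (n * (n.+1 - (weight a b o + weight a b o')))%N.
Proof.
rewrite -(card_ord_range n (weight a b o) (weight_gt0 o')).
rewrite -[X in (X * _)%N](card_ord n) -cardsT -cardsX.
pose f (id : 'Z_n * 'Z_n) : piece n * piece n := ((o, id.1), (o', id.1 + id.2)).
have f_inj : injective f.
  apply: (can_inj (g := fun pq => (pq.1.2, pq.2.2 - pq.1.2))) => -[i d].
  by rewrite /f /= addrC addKr.
rewrite -(card_imset _ f_inj); apply: eq_card => pq.
apply/idP/imsetP => [|[[i d] + ->]]; last first.
  by rewrite !inE /apart !eqxx addrAC subrr add0r.
case: pq => -[u i] [v j]; rewrite !inE /= => /and3P[/eqP-> /eqP-> A].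
by exists (i, j - i); rewrite ?inE // /f /= addrC subrK.
Qed.

(** Ordered pairs are grouped by their owners. The predicate [Q] lets one statement serve both the
    total count and the counts by owner. *)
Lemma double_card_legal (P : pred (position n)) (Q : rel player) :
  (forall p q, p != q -> P [set p; q] = Q p.1 q.1) ->
  (2 * #|[set S : position n | (#|S| == 2) && (legal a b S && P S)]|
   = \sum_(o : player) \sum_(o' : player | Q o o')
       n * (n.+1 - (weight a b o + weight a b o')))%N.
Proof.
move=> PQ; rewrite -card_ordered_pairs pair_big_dep /=.
under [RHS]eq_bigr => o _ do rewrite -card_apart.
rewrite -sum1_card.
rewrite (partition_big (fun pq : piece n * piece n => (pq.1.1, pq.2.1))
   (fun oo => Q oo.1 oo.2)) /=; last first.
  by case=> p q; rewrite inE /= => /and3P[npq _]; rewrite PQ.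
apply: eq_bigr => -[o o'] /= Qo; rewrite sum1_card; apply: eq_card => -[p q].
rewrite !inE unfold_in /= inE /= xpair_eqE -legal_pair.
case: eqVneq => [_|npq] /=; first by rewrite !andbF.
rewrite PQ //; case: eqP => [->|_] /=; last by rewrite andbF.
case: eqP => [->|_] /=; last by rewrite andbF.
by rewrite Qo !andbT.
Qed.

Lemma card_pieces_of_pair o p q : p != q ->
  #|pieces_of o [set p; q]| = ((p.1 == o) + (q.1 == o))%N.
Proof.
move=> npq; rewrite -sum1_card.
under eq_bigl => r do rewrite !inE.
rewrite big_mkcondr /= (bigD1 p) ?eqxx //= (bigD1 q) /=; last first.
  by rewrite eqxx orbT eq_sym.
rewrite big1 ?addn0; first by do 2!case: (_ == o).
by move=> r; case: (r == p); case: (r == q).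
Qed.

Lemma card_pieces_of (S : position n) :
  #|S| = (#|pieces_of Left S| + #|pieces_of Right S|)%N.
Proof.
rewrite -(cardsID [set p : piece n | p.1 == Left] S).
by congr (_ + _)%N; apply: eq_card => -[[] x]; rewrite !inE /= ?andbT ?andbF.
Qed.

Lemma big_player (F : player -> nat) (P : pred player) :
  (\sum_(o | P o) F o
   = (if P Left then F Left else 0) + (if P Right then F Right else 0))%N.
Proof.
rewrite big_mkcond (reindex player_of_bool) /=; last first.
  by exists Defs.is_left => -[].
by rewrite big_bool.
Qed.

Lemma double_f2 :
  (2 * f_ n a b 2 = \sum_(o : player) \sum_(o' : player)
       n * (n.+1 - (weight a b o + weight a b o')))%N.
Proof.
rewrite -(@double_card_legal predT (fun _ _ => true)) //.
by congr (2 * _)%N; apply: eq_card => S; rewrite !inE andbC andbT.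
Qed.

Lemma double_legal_count l r : (l + r = 2)%N ->
  (2 * legal_count n a b l r = \sum_(o : player)
     \sum_(o' : player | ((o == Left) + (o' == Left) == l)%N
                         && ((o == Right) + (o' == Right) == r)%N)
       n * (n.+1 - (weight a b o + weight a b o')))%N.
Proof.
move=> lr; rewrite -(@double_card_legal (fun S : position n =>
  (#|pieces_of Left S| == l) && (#|pieces_of Right S| == r))).
  congr (2 * _)%N; apply: eq_card => S; rewrite !inE (card_pieces_of S).
  (* Prescribing [l] and [r] pieces per owner forces [#|S| = l + r = 2]. *)
  by case: eqP => [->|_]; case: eqP => [->|_]; rewrite ?lr ?andbF.
by move=> p q npq; rewrite !card_pieces_of_pair.
Qed.

End Cycle.

(** Truncation occurs exactly when [n.+1 <= a + b], which is the first branch. *)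
Lemma natr_gap_count (n a b : nat) :
  (n * (n.+1 - (a + b)))%:R =
  (if (n < a + b)%N then 0 else n%:R * (n%:R - a%:R - b%:R + 1)) :> rat.
Proof.
case: ltnP => h; first by rewrite (eqP h) muln0.
by rewrite natrM natrB ?natrD -?natr1 ?natrD; [ring | lia].
Qed.

Theorem proposition5p2 (n a b : nat)
    (hn : (3 <= n)%N) (ha : (1 <= a)%N) (hb : (1 <= b)%N) :
  let N_LL : rat :=
    if (n < 2 * a)%N then 0 else n%:R * (n%:R - 2 * a%:R + 1) / 2 in
  let N_RR : rat :=
    if (n < 2 * b)%N then 0 else n%:R * (n%:R - 2 * b%:R + 1) / 2 in
  let N_LR : rat :=
    if (n < a + b)%N then 0 else n%:R * (n%:R - a%:R - b%:R + 1) in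
  [/\ (f_ n a b 2)%:R = N_LL + N_LR + N_RR,
      (legal_count n a b 2 0)%:R = N_LL,
      (legal_count n a b 0 2)%:R = N_RR
    & (legal_count n a b 1 1)%:R = N_LR].
Proof.
have half (x y : nat) : (2 * x = y)%N -> x%:R = y%:R / 2 :> rat.
  by move=> <-; rewrite natrM; field.
have NE (w : nat) : (if (n < 2 * w)%N then 0
    else n%:R * (n%:R - 2 * w%:R + 1) / 2) = (n * (n.+1 - (w + w)))%:R / 2 :> rat.
  by rewrite natr_gap_count mul2n -addnn; case: ifP => _; [rewrite mul0r | field].
case: n hn half NE => [|[|m]] // _ half NE /=.
rewrite !NE -natr_gap_count.
split; apply: etrans (half _ _ _) _.
- exact: double_f2.
(* The owner pairs ([Left], [Right]) and ([Right], [Left]) contribute equally, so only the mixed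
   term loses its factor 1/2. *)
- by rewrite !big_player /= (addnC b a) !natrD; field.
- exact: double_legal_count.
- by rewrite !big_player /= !addn0.
- exact: double_legal_count.
- by rewrite !big_player.
- exact: double_legal_count.
- by rewrite !big_player /= (addnC b a) !natrD; field.
Qed.
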